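(* Let $\tau\ge 1$ be an integer and let $\rho$ be a real number with $\frac{\tau-1}{\tau+3}<\rho<1$. Let $\{a(t)\}_{t=0}^\infty$ and $\{b(t)\}_{t=0}^\infty$ be real sequences, with $a(0),a(1)\in\mathbb{R}$ given initial values, such that for every integer $t\ge 1$ $$a(t+1)=\rho(t)\bigl(2a(t)-a(t-1)+b(t)-b(t-1)\bigr),$$ where $\rho(t)=\rho$ if $t$ is a multiple of $\tau$ and $\rho(t)=1$ otherwise. Let $\theta$ be the angle with $$\cos\theta=\frac{\rho(\tau+1)+1-\tau}{2\sqrt\rho},\qquad \sin\theta=\frac{\sqrt{4\rho-[\rho(\tau+1)+(1-\tau)]^2}}{2\sqrt\rho},$$ and for integers $s\ge 0$ put $$F_{11}(s)=\frac{\sin((s+1)\theta)}{\sin\theta}+\frac{(\tau-1)\sin(s\theta)}{\sqrt\rho\sin\theta},\qquad F_{12}(s)=-\frac{\tau\sqrt\rho\,\sin(s\theta)}{\sin\theta},$$ $$F_{21}(s)=\frac{\tau\sin(s\theta)}{\sqrt\rho\sin\theta},\qquad F_{22}(s)=-\frac{\sin((s-1)\theta)}{\sin\theta}-\frac{(\tau-1)\sin(s\theta)}{\sqrt\rho\sin\theta},$$ $$G_{11}(s)=\rho\sum_{j=1}^{\tau}j\,[b(s\tau+\tau+1-j)-b(s\tau+\tau-j)],\qquad G_{21}(s)=\sum_{j=1}^{\tau}(j-1)[b(s\tau+\tau+1-j)-b(s\tau+\tau-j)].$$ Then for every integer $k\ge 0$ and every integer $1\le p\le\tau$: $$a(k\tau+p)=p\,a(k\tau+1)-(p-1)a(k\tau)+\sum_{q=1}^{p-1}\sum_{j=1}^{q}\bigl\{b(k\tau+j)-b(k\tau+j-1)\bigr\},$$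 $$a(k\tau+1)=(\sqrt\rho)^k\bigl(F_{11}(k)a(1)+F_{12}(k)a(0)\bigr)+\sum_{s=0}^{k-1}(\sqrt\rho)^{k-1-s}\bigl\{F_{11}(k-1-s)G_{11}(s)+F_{12}(k-1-s)G_{21}(s)\bigr\},$$ $$a(k\tau)=(\sqrt\rho)^k\bigl(F_{21}(k)a(1)+F_{22}(k)a(0)\bigr)+\sum_{s=0}^{k-1}(\sqrt\rho)^{k-1-s}\bigl\{F_{21}(k-1-s)G_{11}(s)+F_{22}(k-1-s)G_{21}(s)\bigr\}.$$
   Context: Empty sums are equal to $0$. *)

(* Defs.v *)
From mathcomp Require Import all_boot all_order all_algebra.
From mathcomp Require Import reals trigo.

Set Implicit Arguments.
Unset Strict Implicit.
Unset Printing Implicit Defensive.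

Import Order.TTheory GRing.Theory Num.Theory.
Local Open Scope ring_scope.

Definition rho_at (R : realType) (tau : nat) (rho : R) (t : nat) : R :=
  if (tau %| t)%N then rho else 1.

Definition F11 (R : realType) (tau : nat) (rho theta : R) (s : nat) : R :=
  sin ((s%:R + 1) * theta) / sin theta
  + (tau%:R - 1) * sin (s%:R * theta) / (Num.sqrt rho * sin theta).

Definition F12 (R : realType) (tau : nat) (rho theta : R) (s : nat) : R :=
  - (tau%:R * Num.sqrt rho * sin (s%:R * theta) / sin theta).

Definition F21 (R : realType) (tau : nat) (rho theta : R) (s : nat) : R :=
  tau%:R * sin (s%:R * theta) / (Num.sqrt rho * sin theta).

(* s%:R - 1 is a subtraction in R, so F22 at s = 0 involves sin (- theta). *)
Definition F22 (R : realType) (tau : nat) (rho theta : R) (s : nat) : R :=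
  - (sin ((s%:R - 1) * theta) / sin theta)
  - (tau%:R - 1) * sin (s%:R * theta) / (Num.sqrt rho * sin theta).

(* The subtractions in the indices of b are never truncated, as j <= tau. *)
Definition G11 (R : realType) (tau : nat) (rho : R) (b : nat -> R) (s : nat) : R :=
  rho * \sum_(1 <= j < tau.+1)
          j%:R * (b (s * tau + tau + 1 - j)%N - b (s * tau + tau - j)%N).

Definition G21 (R : realType) (tau : nat) (b : nat -> R) (s : nat) : R :=
  \sum_(1 <= j < tau.+1)
     (j%:R - 1) * (b (s * tau + tau + 1 - j)%N - b (s * tau + tau - j)%N).

(* Main.v *)
Require Import Defs.
From mathcomp Require Import all_boot all_order all_algebra.
From mathcomp Require Import reals trigo.
From mathcomp Require Import ring lra zify.

(** Write [x k = a (k * tau + 1)] and [y k = a (k * tau)].  Strictly inside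
    a block [k * tau, (k + 1) * tau] the factor [rho_at] is [1], so the recurrence
    says that the second difference of [a] is the first difference of [b]; summing it
    twice gives the first formula ([double_sum_second_difference]).  Evaluated
    at the right end of the block, and once more across it where the factor is
    [rho], it shows that [(x, y)] obeys an affine recurrence with matrix
<<
      M = [ rho (tau + 1)   - rho tau  ]
          [     tau          1 - tau   ]
>>
    and forcing term [(G11, G21)] (lemmas [block_end] and [block_step]).

    Its determinant is [rho] and its trace is
    [rho (tau + 1) + 1 - tau = 2 sqrt rho cos theta], so its eigenvalues are
    [sqrt rho * exp (+- i theta)] and, by Cayley-Hamilton, [(M / sqrt rho) ^ n]
    is the combination of [M] and the identity with Chebyshev coefficients
    [sin (n theta) / sin theta]; its entries are the functions [F11], ...,
    [F22].  This is recorded as [F (n + 1) = (M / sqrt rho) F n], [F 0 = 1]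
    (lemmas [F_at0], [F_row1S], [F_row2S]), and the last
    two formulas are then the variation of constants formula
    ([variation_of_constants]).

    The hypothesis on [rho] enters through [sin theta <> 0]: the eigenvalues are
    not real exactly when [(tau - 1) / (tau + 1) < sqrt rho < 1], and the square
    of that lower bound is at most [(tau - 1) / (tau + 3)]. *)

Set Implicit Arguments.
Unset Strict Implicit.
Unset Printing Implicit Defensive.

Import Order.TTheory GRing.Theory Num.Theory.
Local Open Scope ring_scope.

(** * Repeated summation of second differences *)

(** The induction must carry the first difference along, since one step of the
    recurrence involves two previous values. *)
Lemma double_sum_second_difference (R : comNzRingType) (n : nat)
    (c d : nat -> R) :
  (forall q, (1 <= q < n)%N -> c q.+1 = 2 * c q - c q.-1 + d q) ->
  forall p, (p < n)%N ->
    c p.+1 - c p = c 1%N - c 0%N + \sum_(1 <= j < p.+1) d j /\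
    c p.+1 = p.+1%:R * c 1%N - (p.+1%:R - 1) * c 0%N
             + \sum_(1 <= q < p.+1) \sum_(1 <= j < q.+1) d j.
Proof.
move=> hc; elim=> [|p IHp] ltpn.
  by rewrite !big_geq //; split; ring.
have [IHdiff IHval] := IHp (ltnW ltpn).
have diff : c p.+2 - c p.+1 = c 1%N - c 0%N + \sum_(1 <= j < p.+2) d j.
  rewrite hc ?ltpn //= big_nat_recr //= addrA -IHdiff; ring.
split=> //.
rewrite [LHS](_ : _ = (c p.+2 - c p.+1) + c p.+1); last by ring.
rewrite diff IHval [in RHS]big_nat_recr //= -[p.+2]addn1 natrD; ring.
Qed.

(** Both sides give [d i] the weight [n + 1 - i]: on the left by reversing the
    order of summation, on the right by counting the [q >= i]. *)
Lemma sum_mul_rev (R : comNzRingType) (n : nat) (d : nat -> R) :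
  \sum_(1 <= j < n.+1) j%:R * d (n.+1 - j)%N
  = \sum_(1 <= q < n.+1) \sum_(1 <= j < q.+1) d j.
Proof.
elim: n => [|n IHn]; first by rewrite !big_geq.
rewrite [RHS]big_nat_recr //= -IHn big_nat_recl // mul1r subn1 /=.
under eq_bigr do rewrite subSS -natr1 mulrDl mul1r.
rewrite big_split /= addrCA; congr (_ + _).
rewrite [in RHS]big_nat_recr //= addrC; congr (_ + _).
rewrite big_nat_rev /=; apply: eq_big_nat => i hi; congr d; lia.
Qed.

(** Lowering every weight of [sum_mul_rev] by one removes the sum of all [d j],
    which is the inner sum for [q = n]. *)
Lemma sum_pred_mul_rev (R : comNzRingType) (n : nat) (d : nat -> R) :
  \sum_(1 <= j < n.+1) (j%:R - 1) * d (n.+1 - j)%N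
  = \sum_(1 <= q < n) \sum_(1 <= j < q.+1) d j.
Proof.
case: n => [|n]; first by rewrite !big_geq.
rewrite big_nat_recl // subrr mul0r add0r -sum_mul_rev.
by apply: eq_bigr => i _; rewrite -natr1 addrK subSS.
Qed.

(** * Planar affine recurrences *)

(** [P] is the fundamental solution, that is [P n] is the [n]-th power of the
    matrix of the recurrence. *)
Lemma variation_of_constants (R : comNzRingType) (m11 m12 m21 m22 : R)
    (P11 P12 P21 P22 x y g h : nat -> R) :
  P11 0%N = 1 -> P12 0%N = 0 -> P21 0%N = 0 -> P22 0%N = 1 ->
  (forall n, P11 n.+1 = m11 * P11 n + m12 * P21 n) ->
  (forall n, P12 n.+1 = m11 * P12 n + m12 * P22 n) ->
  (forall n, P21 n.+1 = m21 * P11 n + m22 * P21 n) ->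
  (forall n, P22 n.+1 = m21 * P12 n + m22 * P22 n) ->
  (forall k, x k.+1 = m11 * x k + m12 * y k + g k) ->
  (forall k, y k.+1 = m21 * x k + m22 * y k + h k) ->
  forall k,
    x k = P11 k * x 0%N + P12 k * y 0%N
          + \sum_(0 <= s < k) (P11 (k - 1 - s)%N * g s + P12 (k - 1 - s)%N * h s)
 /\ y k = P21 k * x 0%N + P22 k * y 0%N
          + \sum_(0 <= s < k) (P21 (k - 1 - s)%N * g s + P22 (k - 1 - s)%N * h s).
Proof.
move=> P110 P120 P210 P220 P11S P12S P21S P22S xS yS.
elim=> [|k [IHx IHy]].
  by rewrite !big_geq // P110 P120 P210 P220; split; ring.
(* Every summand but the last is the matrix times the corresponding one for
   [k]; the last one is the forcing term, since [P 0] is the identity. *)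
have sumS (Q1 Q2 A1 A2 B1 B2 : nat -> R) (u v : R) :
    (forall n, Q1 n.+1 = u * A1 n + v * B1 n) ->
    (forall n, Q2 n.+1 = u * A2 n + v * B2 n) ->
    \sum_(0 <= s < k.+1) (Q1 (k.+1 - 1 - s)%N * g s + Q2 (k.+1 - 1 - s)%N * h s)
    = u * (\sum_(0 <= s < k) (A1 (k - 1 - s)%N * g s + A2 (k - 1 - s)%N * h s))
    + v * (\sum_(0 <= s < k) (B1 (k - 1 - s)%N * g s + B2 (k - 1 - s)%N * h s))
    + (Q1 0%N * g k + Q2 0%N * h k).
  move=> Q1S Q2S; rewrite big_nat_recr //= subn1 /= subnn; congr (_ + _).
  rewrite !mulr_sumr -big_split /=; apply: eq_big_nat => s hs.
  have -> : (k - s = (k - 1 - s).+1)%N by lia.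
  rewrite Q1S Q2S; ring.
split.
  rewrite xS IHx IHy (sumS _ _ _ _ _ _ _ _ P11S P12S) P11S P12S P110 P120; ring.
rewrite yS IHx IHy (sumS _ _ _ _ _ _ _ _ P21S P22S) P21S P22S P210 P220; ring.
Qed.

(** * The rescaled powers of the transfer matrix *)

Lemma sinD1_mul (R : realType) (x theta : R) :
  sin ((x + 1) * theta)
  = 2 * cos theta * sin (x * theta) - sin ((x - 1) * theta).
Proof. by rewrite mulrDl mulrBl mul1r sinD sinB; ring. Qed.

(** The two factors of the discriminant are [2 r - trace] and [2 r + trace] for
    [r = sqrt rho]; both split further, as [(1 - r) ((tau + 1) r + (tau - 1))]
    and [(1 + r) ((tau + 1) r - (tau - 1))]. *)
Lemma discriminant_gt0 (R : realType) (t r : R) :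
  1 <= t -> 0 < r -> (t - 1) / (t + 3) < r ^+ 2 -> r < 1 ->
  0 < 4 * r ^+ 2 - (r ^+ 2 * (t + 1) + (1 - t)) ^+ 2.
Proof.
move=> t1 r0; rewrite ltr_pdivrMr; last lra.
move=> hr r1.
have lower : t - 1 < (t + 1) * r.
  rewrite -(@ltr_pXn2r _ 2) ?nnegrE //; [|lra|apply: mulr_ge0; lra].
  rewrite exprMn.
  (* [(t - 1) (t + 3) <= (t + 1) ^ 2] turns the hypothesis into this bound. *)
  have h1 : (t - 1) * (t - 1) * (t + 3) <= (t - 1) * (t + 1) ^+ 2 by nra.
  have h2 : (t - 1) * (t + 1) ^+ 2 < r ^+ 2 * (t + 3) * (t + 1) ^+ 2.
    by rewrite ltr_pM2r //; apply: exprn_gt0; lra.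
  by rewrite -(@ltr_pM2r _ (t + 3)); lra.
rewrite [ltRHS](_ : _ = ((1 - r) * ((t + 1) * r + (t - 1)))
   * ((1 + r) * ((t + 1) * r - (t - 1)))); last by ring.
have ? : 0 < (t + 1) * r by apply: mulr_gt0; lra.
by apply: mulr_gt0; apply: mulr_gt0; lra.
Qed.

Lemma F_at0 (R : realType) (tau : nat) (rho theta : R) : sin theta != 0 ->
  [/\ F11 tau rho theta 0 = 1, F12 tau rho theta 0 = 0,
      F21 tau rho theta 0 = 0 & F22 tau rho theta 0 = 1].
Proof.
move=> s0; rewrite /F11 /F12 /F21 /F22 add0r sub0r mul1r mulN1r mul0r.
by rewrite sin0 sinN mulNr opprK divff // !mulr0 !mul0r !oppr0 !addr0.
Qed.

Section PowersOfTransferMatrix.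

Variables (R : realType) (tau : nat) (rho theta : R).
Hypotheses (rho_gt0 : 0 < rho) (sin_neq0 : sin theta != 0).
Hypothesis cosE :
  cos theta = (rho * (tau%:R + 1) + 1 - tau%:R) / (2 * Num.sqrt rho).

Let sqrt_neq0 : Num.sqrt rho != 0.
Proof. by rewrite gt_eqF ?sqrtr_gt0. Qed.

Let rhoE : rho = Num.sqrt rho ^+ 2.
Proof. by rewrite sqr_sqrtr ?ltW. Qed.

(** In terms of [sin (n theta)] and [sin ((n - 1) theta)] both sides are linear
    and the value of [cos theta] makes their coefficients agree. *)
Lemma F_row1S n :
  Num.sqrt rho * F11 tau rho theta n.+1
    = rho * (tau%:R + 1) * F11 tau rho theta n
      + - (rho * tau%:R) * F21 tau rho theta n /\
  Num.sqrt rho * F12 tau rho theta n.+1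
    = rho * (tau%:R + 1) * F12 tau rho theta n
      + - (rho * tau%:R) * F22 tau rho theta n.
Proof.
rewrite /F11 /F12 /F21 /F22 -natr1 !sinD1_mul addrK cosE.
move: sqrt_neq0 rhoE; set r := Num.sqrt rho => r0 ->.
by split; field; rewrite ?r0 ?sin_neq0.
Qed.

Lemma F_row2S n :
  Num.sqrt rho * F21 tau rho theta n.+1
    = tau%:R * F11 tau rho theta n + (1 - tau%:R) * F21 tau rho theta n /\
  Num.sqrt rho * F22 tau rho theta n.+1
    = tau%:R * F12 tau rho theta n + (1 - tau%:R) * F22 tau rho theta n.
Proof.
rewrite /F11 /F12 /F21 /F22 -natr1 addrK !sinD1_mul cosE.
move: sqrt_neq0 rhoE; set r := Num.sqrt rho => r0 ->.
by split; field; rewrite ?r0 ?sin_neq0.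
Qed.

End PowersOfTransferMatrix.

(** * The recurrence from block to block *)

Section Blocks.

Variables (R : realType) (tau : nat) (rho : R) (a b : nat -> R).
Hypothesis tau_gt0 : (1 <= tau)%N.
Hypothesis aS : forall t : nat, (1 <= t)%N ->
  a (t + 1)%N =
    rho_at tau rho t * (2 * a t - a (t - 1)%N + b t - b (t - 1)%N).

Let db k j := b (k * tau + j)%N - b (k * tau + j - 1)%N.

Lemma block_interior k p : (p < tau)%N ->
  a (k * tau + p.+1)%N - a (k * tau + p)%N
    = a (k * tau + 1)%N - a (k * tau)%N + \sum_(1 <= j < p.+1) db k j /\
  a (k * tau + p.+1)%N
    = p.+1%:R * a (k * tau + 1)%N - (p.+1%:R - 1) * a (k * tau)%N
      + \sum_(1 <= q < p.+1) \sum_(1 <= j < q.+1) db k j.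
Proof.
move=> ltp; have := @double_sum_second_difference _ tau
  (fun p => a (k * tau + p)%N) (db k).
rewrite /= addn0; apply=> // q /andP[q1 qtau].
have -> : (k * tau + q.+1 = k * tau + q + 1)%N by lia.
rewrite aS; last by lia.
rewrite /rho_at dvdn_addr ?dvdn_mull // gtnNdvd // mul1r /db.
have -> : (k * tau + q - 1 = k * tau + q.-1)%N by lia.
by rewrite addrA.
Qed.

Let G11E k :
  G11 tau rho b k = rho * \sum_(1 <= q < tau.+1) \sum_(1 <= j < q.+1) db k j.
Proof.
rewrite -sum_mul_rev; congr (_ * _); apply: eq_big_nat => j hj.
by rewrite /db; congr (_ * (b _ - b _)); lia.
Qed.

Let G21E k :
  G21 tau b k = \sum_(1 <= q < tau) \sum_(1 <= j < q.+1) db k j.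
Proof.
rewrite -sum_pred_mul_rev; apply: eq_big_nat => j hj.
by rewrite /db; congr (_ * (b _ - b _)); lia.
Qed.

Lemma block_end k :
  a (k.+1 * tau)%N
  = tau%:R * a (k * tau + 1)%N + (1 - tau%:R) * a (k * tau)%N + G21 tau b k.
Proof.
have lt_pred : (tau.-1 < tau)%N by rewrite prednK.
have [_] := block_interior k lt_pred; rewrite prednK // -G21E.
have -> : (k.+1 * tau = k * tau + tau)%N by lia.
by move=> ->; ring.
Qed.

(** Besides the value at the end of the block, the step across it needs the
    last first difference inside the block. *)
Lemma block_step k :
  a (k.+1 * tau + 1)%N
  = rho * (tau%:R + 1) * a (k * tau + 1)%N + - (rho * tau%:R) * a (k * tau)%N
    + G11 tau rho b k.
Proof.
have lt_pred : (tau.-1 < tau)%N by rewrite prednK.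
have [] := block_interior k lt_pred; rewrite prednK // => diff val.
have eS : (k.+1 * tau = k * tau + tau)%N by lia.
rewrite aS ?muln_gt0 // /rho_at dvdn_mull // eS.
have -> : a (k * tau + tau - 1)%N = a (k * tau + tau.-1)%N by congr a; lia.
rewrite -addrA -/(db k tau).
rewrite [X in rho * X](_ : _ = a (k * tau + tau)%N
   + (a (k * tau + tau)%N - a (k * tau + tau.-1)%N) + db k tau); last by ring.
rewrite diff val G11E [in RHS]big_nat_recr //= (@big_nat_recr _ _ _ tau) //=.
ring.
Qed.

End Blocks.

Theorem lemma1 (R : realType) (tau : nat) (rho : R) (a b : nat -> R) (theta : R)
  (htau : (1 <= tau)%N)
  (hrho_gt : (tau%:R - 1) / (tau%:R + 3) < rho)
  (hrho_lt1 : rho < 1)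
  (hrec : forall t : nat, (1 <= t)%N ->
     a (t + 1)%N =
       rho_at tau rho t * (2 * a t - a (t - 1)%N + b t - b (t - 1)%N))
  (hcos : cos theta =
     (rho * (tau%:R + 1) + 1 - tau%:R) / (2 * Num.sqrt rho))
  (hsin : sin theta =
     Num.sqrt (4 * rho - (rho * (tau%:R + 1) + (1 - tau%:R)) ^+ 2)
       / (2 * Num.sqrt rho)) :
  forall k p : nat, (1 <= p <= tau)%N ->
  [/\ a (k * tau + p)%N =
        p%:R * a (k * tau + 1)%N - (p%:R - 1) * a (k * tau)%N
        + \sum_(1 <= q < p) \sum_(1 <= j < q.+1)
            (b (k * tau + j)%N - b (k * tau + j - 1)%N),
      a (k * tau + 1)%N =
        Num.sqrt rho ^+ k
          * (F11 tau rho theta k * a 1%N + F12 tau rho theta k * a 0%N)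
        + \sum_(0 <= s < k) Num.sqrt rho ^+ (k - 1 - s)
            * (F11 tau rho theta (k - 1 - s) * G11 tau rho b s
               + F12 tau rho theta (k - 1 - s) * G21 tau b s)
    & a (k * tau)%N =
        Num.sqrt rho ^+ k
          * (F21 tau rho theta k * a 1%N + F22 tau rho theta k * a 0%N)
        + \sum_(0 <= s < k) Num.sqrt rho ^+ (k - 1 - s)
            * (F21 tau rho theta (k - 1 - s) * G11 tau rho b s
               + F22 tau rho theta (k - 1 - s) * G21 tau b s)].
Proof.
have tau_ge1 : 1 <= tau%:R :> R by rewrite ler1n.
have rho_gt0 : 0 < rho.
  by apply: le_lt_trans hrho_gt; apply: divr_ge0; lra.
have sqrt_gt0 : 0 < Num.sqrt rho by rewrite sqrtr_gt0.
have rhoE : Num.sqrt rho ^+ 2 = rho by rewrite sqr_sqrtr ?ltW.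
have sin_neq0 : sin theta != 0.
  rewrite hsin gt_eqF // divr_gt0 ?mulr_gt0 // sqrtr_gt0 -rhoE.
  apply: discriminant_gt0; rewrite ?rhoE //.
  by rewrite -sqrtr1 ltr_sqrt.
have [F110 F120 F210 F220] := F_at0 tau rho sin_neq0.
have row1 := F_row1S rho_gt0 sin_neq0 hcos.
have row2 := F_row2S rho_gt0 sin_neq0 hcos.
move=> k [//|p] /= ltp; pose r := Num.sqrt rho.
(* The power of [sqrt rho] turns the recurrence of [F] into that of [M ^ n]. *)
have PS (f g h : nat -> R) (u v : R) :
    (forall n, r * f n.+1 = u * g n + v * h n) ->
    forall n, r ^+ n.+1 * f n.+1 = u * (r ^+ n * g n) + v * (r ^+ n * h n).
  by move=> e n; rewrite exprSr -mulrA e; ring.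
have [||||||||solx soly] := @variation_of_constants R
  (rho * (tau%:R + 1)) (- (rho * tau%:R)) tau%:R (1 - tau%:R)
  (fun n => r ^+ n * F11 tau rho theta n) (fun n => r ^+ n * F12 tau rho theta n)
  (fun n => r ^+ n * F21 tau rho theta n) (fun n => r ^+ n * F22 tau rho theta n)
  (fun k => a (k * tau + 1)%N) (fun k => a (k * tau)%N)
  (G11 tau rho b) (G21 tau b)
  _ _ _ _ _ _ _ _ (block_step htau hrec) (block_end htau hrec) k.
1-4: by rewrite ?F110 ?F120 ?F210 ?F220 ?mulr0 ?mulr1.
- by apply: PS => n; have [] := row1 n.
- by apply: PS => n; have [] := row1 n.
- by apply: PS => n; have [] := row2 n.
- by apply: PS => n; have [] := row2 n.
have distr n (u v w z : R) :
    r ^+ n * u * w + r ^+ n * v * z = r ^+ n * (u * w + v * z).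
  by rewrite mulrDr !mulrA.
split.
- by have [] := block_interior htau hrec k ltp.
- rewrite solx mul0n add0n distr; congr (_ + _).
  by apply: eq_bigr => s _; rewrite distr.
- rewrite soly mul0n add0n distr; congr (_ + _).
  by apply: eq_bigr => s _; rewrite distr.
Qed.
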